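(* Let $\eta=e^{\pi i/3}$. Let $\Gamma\subset\mathbb{H}\rtimes S^1$ be a Heisenberg Bieberbach group satisfying $\mathrm{pr}_2(\Gamma)=\langle\eta\rangle$. Put $\Lambda=\Gamma\cap\mathbb{H}$, $N=\#(Z(\Lambda)/[\Lambda,\Lambda])$ and $c=4\operatorname{Im}\eta/N$. Define $$\Gamma_c := \langle\Lambda_{\eta,c},\ \psi := (0,c/6)\,\mu(\eta)\rangle,\qquad \Gamma_c' := \langle\Lambda_{\eta,c},\ \psi' := (0,5c/6)\,\mu(\eta)\rangle.$$ Then $N$ must be even and the conjugacy class of $\Gamma$ in $\mathbb{H}\rtimes\mathbb{C}^*$ depends on $N$ modulo $3$ as follows. If $N\equiv0\pmod 3$, then $\Gamma$ is conjugate in $\mathbb{H}\rtimes\mathbb{C}^*$ to either $\Gamma_c$ or $\Gamma_c'$. If $N\equiv1\pmod 3$, then $\Gamma$ is conjugate to $\Gamma_c$. If $N\equiv2\pmod 3$, then $\Gamma$ is conjugate to $\Gamma_c'$.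
   Context: The Heisenberg group is $\mathbb{H} = \mathbb{C}\times\mathbb{R}$ with multiplication $(z,t)\cdot(z',t') = (z+z', t+t'+2\operatorname{Im}(z\bar z'))$. For $\lambda \in \mathbb{C}^*$ let $\mu(\lambda)(z,t) = (\lambda z, |\lambda|^2 t)$. The group $\mathbb{H}\rtimes\mathbb{C}^*$ is the set $\mathbb{H}\times\mathbb{C}^*$ with $(g,\lambda)\cdot(h,\nu) = (g\cdot\mu(\lambda)(h), \lambda\nu)$; it acts on $\mathbb{H}$ from the left by $(g,\lambda)h = g\cdot\mu(\lambda)(h)$, and $(g,\lambda)$ is also written $g\,\mu(\lambda)$. $\mathbb{H}$ is regarded as the subgroup of elements $(g,1)$, $\mathbb{H}\rtimes S^1$ is the subgroup of elements $(g,\lambda)$ with $|\lambda|=1$, and $\mathrm{pr}_2: \mathbb{H}\rtimes\mathbb{C}^*\to\mathbb{C}^*$ is the second projection. A Heisenberg Bieberbach group is a discrete torsion-free subgroup $\Gamma\subset\mathbb{H}\rtimes S^1$ such that $\Gamma\backslash\mathbb{H}$ is compact; then $\Lambda=\Gamma\cap\mathbb{H}$ is a lattice (co-compact discrete subgroup) in $\mathbb{H}$, and $Z(\Lambda)/[\Lambda,\Lambda]$ is finite, where $Z(\Lambda)$ denotes the center and $[\Lambda,\Lambda]$ the commutator subgroup. For $\tau\in\mathbb{C}$ and $c>0$ with $4\operatorname{Im}\tau/c\in\mathbb{Z}_{>0}$, $\Lambda_{\tau,c} := \langle (1,0),(\tau,0),(0,c)\rangle \subset \mathbb{H}$; here $\tau=\eta$.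 Angle brackets denote the subgroup generated. *)

(* Defs.v *)
From HB Require Import structures.
From mathcomp Require Import all_boot all_order all_algebra generic_quotient.
From mathcomp Require Import all_classical all_reals all_analysis.
From mathcomp Require Import complex.
From mathcomp Require Import ring.

Set Implicit Arguments.
Unset Strict Implicit.
Unset Printing Implicit Defensive.

Import Order.TTheory GRing.Theory Num.Theory.
Import numFieldNormedType.Exports.

Local Open Scope classical_set_scope.
Local Open Scope ring_scope.
Local Open Scope complex_scope.

Section GroupNotions.
Local Open Scope group_scope.
Variable G : groupType.
Implicit Types A K : set G.

Definition subgroup A : Prop := group_closed (mem A).

Definition generated A : set G := smallest subgroup A.

Definition group_center A : set G := [set z | A z /\ forall x, A x -> commute z x].

Definition derived A : set G := generated [set [~ x, y] | x in A & y in A].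

Definition lcosets A K : set (set G) := [set [set x * k | k in K] | x in A].

Definition conjugate A K : Prop :=
  exists g : G, A = [set g * x * g^-1 | x in K].

Definition torsion_free A : Prop :=
  forall (x : G) (n : nat), A x -> (0 < n)%N -> x ^+ n = 1 -> x = 1.

End GroupNotions.

(* Norm topology on R[i]; radii live in R[i], where [0 < e] forces [e] real. *)
HB.instance Definition _ (R : realType) := NormedModule.copy R[i] (R[i])^o.

(* e^(i t), by Euler's formula *)
Definition expi (R : realType) (t : R) : R[i] := cos t +i* sin t.

Lemma expi_neq0 (R : realType) (t : R) : expi t != 0.
Proof.
apply/eqP => -[c0 s0]; have := cos2Dsin2 t.
by rewrite c0 s0 expr0n addr0 => /esym/eqP; rewrite oner_eq0.
Qed.

Section Cstar.
Variable R : realType.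

Definition Cstar : Type := {z : R[i] | z != 0}.

HB.instance Definition _ := SubChoice.on Cstar.
HB.instance Definition _ :=
  Topological.copy Cstar (initial_topology (val : Cstar -> R[i])).

Definition cstar (z : R[i]) (z0 : z != 0) : Cstar := exist _ z z0.

Lemma cstar_mul_neq0 (x y : Cstar) : val x * val y != 0.
Proof. by rewrite mulf_neq0 ?(valP x) ?(valP y). Qed.

Lemma cstar_inv_neq0 (x : Cstar) : (val x)^-1 != 0.
Proof. by rewrite invr_neq0 ?(valP x). Qed.

Definition cstar_one : Cstar := cstar (oner_neq0 R[i]).
Definition cstar_mul (x y : Cstar) : Cstar := cstar (cstar_mul_neq0 x y).
Definition cstar_inv (x : Cstar) : Cstar := cstar (cstar_inv_neq0 x).

Lemma cstar_mulA : associative cstar_mul.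
Proof. by move=> x y z; apply: val_inj; rewrite /= mulrA. Qed.
Lemma cstar_mul1 : left_id cstar_one cstar_mul.
Proof. by move=> x; apply: val_inj; rewrite /= mul1r. Qed.
Lemma cstar_1mul : right_id cstar_one cstar_mul.
Proof. by move=> x; apply: val_inj; rewrite /= mulr1. Qed.
Lemma cstar_mulV : left_inverse cstar_one cstar_inv cstar_mul.
Proof. by move=> x; apply: val_inj; rewrite /= mulVf ?(valP x). Qed.
Lemma cstar_Vmul : right_inverse cstar_one cstar_inv cstar_mul.
Proof. by move=> x; apply: val_inj; rewrite /= mulfV ?(valP x). Qed.

HB.instance Definition _ := isGroup.Build Cstar
  cstar_mulA cstar_mul1 cstar_1mul cstar_mulV cstar_Vmul.

End Cstar.

Section Heisenberg.
Variable R : realType.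

Definition heis : Type := (R[i] * R)%type.

HB.instance Definition _ := Topological.copy heis (R[i] * R)%type.

Definition heis_mul (g h : heis) : heis :=
  (g.1 + h.1, g.2 + h.2 + 2 * complex.Im (g.1 * h.1^*)).
Definition heis_one : heis := (0, 0).
Definition heis_inv (g : heis) : heis := (- g.1, - g.2).

Lemma heis_mulA : associative heis_mul.
Proof.
move=> [[a b] t] [[a' b'] t'] [[a'' b''] t''].
by rewrite /heis_mul /=; congr (_ +i* _, _); ring.
Qed.
Lemma heis_mul1 : left_id heis_one heis_mul.
Proof.
by move=> [[a b] t]; rewrite /heis_mul /=; congr (_ +i* _, _); ring.
Qed.
Lemma heis_1mul : right_id heis_one heis_mul.
Proof.
by move=> [[a b] t]; rewrite /heis_mul /=; congr (_ +i* _, _); ring.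
Qed.
Lemma heis_mulV : left_inverse heis_one heis_inv heis_mul.
Proof.
by move=> [[a b] t]; rewrite /heis_mul /=; congr (_ +i* _, _); ring.
Qed.
Lemma heis_Vmul : right_inverse heis_one heis_inv heis_mul.
Proof.
by move=> [[a b] t]; rewrite /heis_mul /=; congr (_ +i* _, _); ring.
Qed.

HB.instance Definition _ := isGroup.Build heis
  heis_mulA heis_mul1 heis_1mul heis_mulV heis_Vmul.

(* `|z| has type R[i]; [complex.Re] reads its square back in R. *)
Definition mu (l : Cstar R) (h : heis) : heis :=
  (val l * h.1, complex.Re (`|val l| ^+ 2) * h.2).

Local Open Scope group_scope.

Lemma mu1 (h : heis) : mu 1 h = h.
Proof.
case: h => z t; rewrite -[LHS]/(1 * z, complex.Re (`|1| ^+ 2) * t)%R.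
by rewrite normr1 expr1n /= !mul1r.
Qed.

Lemma Re_sqr_norm (z : R[i]) :
  complex.Re (`|z| ^+ 2)%R = (complex.Re z ^+ 2 + complex.Im z ^+ 2)%R.
Proof. by rewrite -add_Re2_Im2. Qed.

Lemma muM (l n : Cstar R) (h : heis) : mu (l * n) h = mu l (mu n h).
Proof.
case: h l n => [z t] [[a b] l0] [[c d] n0].
rewrite -[LHS]/(((a +i* b) * (c +i* d)) * z,
  complex.Re (`|(a +i* b) * (c +i* d)| ^+ 2) * t)%R /mu !Re_sqr_norm /=.
by rewrite mulrA; congr pair; ring.
Qed.

Lemma mu_morph (l : Cstar R) : {morph mu l : g h / g * h}.
Proof.
case: l => [[a b] l0] [[x y] t] [[x' y'] t'].
rewrite -[LHS]/(mu _ (heis_mul _ _)) -[RHS]/(heis_mul _ _) /mu.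
rewrite !Re_sqr_norm /heis_mul /=.
by congr (_ +i* _, _); ring.
Qed.

Definition heisC : Type := (heis * Cstar R)%type.

HB.instance Definition _ := Topological.copy heisC (heis * Cstar R)%type.

Definition heisC_mul (x y : heisC) : heisC := (x.1 * mu x.2 y.1, x.2 * y.2).
Definition heisC_one : heisC := (1, 1).
Definition heisC_inv (x : heisC) : heisC := (mu x.2^-1 x.1^-1, x.2^-1).

Lemma mu_1 (l : Cstar R) : mu l 1 = 1.
Proof. by rewrite /mu /= !mulr0. Qed.

Lemma heisC_mulA : associative heisC_mul.
Proof.
by move=> x y z; rewrite /heisC_mul /= mu_morph muM !mulgA.
Qed.
Lemma heisC_mul1 : left_id heisC_one heisC_mul.
Proof. by case=> g l; rewrite /heisC_mul /= mu1 !mul1g. Qed.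
Lemma heisC_1mul : right_id heisC_one heisC_mul.
Proof. by case=> g l; rewrite /heisC_mul /= mu_1 !mulg1. Qed.
Lemma heisC_mulV : left_inverse heisC_one heisC_inv heisC_mul.
Proof. by case=> g l; rewrite /heisC_mul /= -mu_morph !mulVg mu_1. Qed.
Lemma heisC_Vmul : right_inverse heisC_one heisC_inv heisC_mul.
Proof. by case=> g l; rewrite /heisC_mul /= -muM !mulgV mu1 mulgV. Qed.

HB.instance Definition _ := isGroup.Build heisC
  heisC_mulA heisC_mul1 heisC_1mul heisC_mulV heisC_Vmul.

Definition inH (g : heis) : heisC := (g, 1).

Definition pr2 (x : heisC) : Cstar R := x.2.

Definition act (x : heisC) (h : heis) : heis := x.1 * mu x.2 h.

Lemma act1 h : act 1 h = h.
Proof. by rewrite /act mu1 mul1g. Qed.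

Lemma actM x y h : act (x * y) h = act x (act y h).
Proof. by rewrite /act /= mu_morph muM mulgA. Qed.

Section OrbitSpace.
Variables (Gamma : set heisC) (sG : subgroup Gamma).

Definition same_orbit (h k : heis) : bool :=
  `[< exists2 x, Gamma x & k = act x h >].

Lemma same_orbit_equiv : equiv_class_of same_orbit.
Proof.
have [G1 GV] := sG; have G1' : Gamma 1 by exact: set_mem.
have GF x y : Gamma x -> Gamma y -> Gamma (x / y).
  by move=> Gx Gy; apply: set_mem; apply: GV; apply: mem_set.
have GVV x : Gamma x -> Gamma x^-1 by move=> Gx; rewrite -div1g; exact: GF.
split.
- by move=> h; apply/asboolP; exists 1; rewrite ?act1.
- move=> h k; apply/asboolP/asboolP => -[x Gx ->]; exists x^-1 => //;
    by [exact: GVV | rewrite -actM mulVg act1].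
- move=> k h m /asboolP[x Gx ->] /asboolP[y Gy ->]; apply/asboolP.
  exists (y * x); last by rewrite actM.
  by rewrite -[x]invgK; apply: GF => //; exact: GVV.
Qed.

Definition orbit_equiv : equiv_rel heis := EquivRelPack same_orbit_equiv.

Definition orbit_space : Type := quotient_topology {eq_quot orbit_equiv}%qT.
HB.instance Definition _ := Topological.on orbit_space.

End OrbitSpace.

(* [hb_unitary]: Gamma lies in the subgroup H x| S^1. *)
Record heisenberg_bieberbach (Gamma : set heisC) : Prop := HeisenbergBieberbach {
  hb_subgroup : subgroup Gamma ;
  hb_unitary : forall x, Gamma x -> `|val (pr2 x)|%R = 1%R ;
  hb_discrete : Gamma `<=` isolated Gamma ;
  hb_torsion_free : torsion_free Gamma ;
  hb_cocompact : compact [set: orbit_space hb_subgroup]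
}.

Definition Lambda_std (tau : R[i]) (c : R) : set heis :=
  generated ([set (1, 0); (tau, 0); (0, c)]%R : set heis).

Definition eta : Cstar R := cstar (expi_neq0 (pi / 3))%R.

(* (0, s) mu(eta) *)
Definition psi (s : R) : heisC := ((0%R, s), eta).

Definition Gamma_c (c : R) : set heisC :=
  generated (inH @` Lambda_std (val eta) c `|` [set psi (c / 6)%R]).

Definition Gamma_c' (c : R) : set heisC :=
  generated (inH @` Lambda_std (val eta) c `|` [set psi (5 * c / 6)%R]).

End Heisenberg.

(* Main.v *)
Require Import Defs.
From mathcomp Require Import all_boot all_order all_algebra generic_quotient.
From mathcomp Require Import all_classical all_reals all_analysis.
From mathcomp Require Import complex.
From mathcomp Require Import ring lra zify.

(** Write [Lambda] for the translations in [Gamma], fix an element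
    [g = (w, s) mu(eta)] of [Gamma], and let [e = Im eta = sqrt 3 / 2].

    - The vertical part of [Lambda] is a discrete subgroup of the line, and
      it is nonzero because [g ^+ 6] is vertical and [Gamma] is torsion-free;
      so it is [d Z] for some [d > 0] ([exists_vertical_period]).
    - The projection [L] of [Lambda] to the plane is stable under [eta],
      since conjugation by [g] rotates the plane. The commutator of lifts of
      [z] and [eta z] is vertical of height [- 4 e |z|^2], a multiple of [d]:
      squared lengths in [L] are thus quantized, [L] has a shortest nonzero
      vector [a], and Euclidean division in [Z[eta]] gives [L = a Z[eta]]
      ([exists_horizontal_ideal]). Cocompactness enters only to show
      [L != 0]: otherwise [Gamma] would preserve the distance to a vertical
      axis, an unbounded function ([exists_horizontal]).
    - Now the center of [Lambda] is [d Z] and its derived subgroup is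
      [4 |a|^2 e Z], whence [N d = 4 |a|^2 e] ([lattice_index]).

    Conjugating by [(z0, 0) mu(a)], where [z0] is the point of the plane
    fixed by [g], one may assume [a = 1], [d = c = 4 e / N] and
    [g = (0, s) mu(eta)]. Then [6 s = k c] for an integer [k], because
    [g ^+ 6 = (0, 6 s)]. Comparing two lifts of [eta^2 = eta - 1] shows that
    the lifts of [1] have heights in [c Z - N c / 2] ([horizontal_height]).

    Torsion-freeness is a set of congruences on [k]. An element over
    [eta^3 = -1] is an involution as soon as its height vanishes, so [k] is
    odd (from [z = 0]) and [k - N] is odd (from [z = 1]); hence [N] is even.
    An element over [eta^2] with planar part [z] and height [t] has as cube
    the vertical element [3 t - 2 e |z|^2], so [3] divides neither [k] (from
    [z = 0]) nor [k + N] (from [z = 1]). Modulo [6] this leaves [k = 1] or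
    [k = 5], only [k = 1] if [N = 1] modulo [3], and only [k = 5] if [N = 2]
    modulo [3]. Multiplying [g] by [(0, c)] changes [k] by [6], so [Gamma]
    contains [psi] or [psi'], and it is then generated by that element and
    [Lambda] ([eq_generated_psi]). *)

Import Order.TTheory GRing.Theory Num.Theory.
Import numFieldNormedType.Exports.

Local Open Scope classical_set_scope.
Local Open Scope card_scope.
Local Open Scope ring_scope.

(** * Subgroups and generation *)

Section Subgroups.
Context {G : groupType}.
Implicit Types A : set G.
Local Open Scope group_scope.

Lemma subgroup1 {A} : subgroup A -> A 1.
Proof. by case=> A1 _; exact: set_mem. Qed.

Lemma subgroupF {A} : subgroup A -> forall x y, A x -> A y -> A (x / y).
Proof.
by case=> _ AF x y Ax Ay; apply: set_mem; apply: AF; exact: mem_set.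
Qed.

Lemma subgroupV {A} : subgroup A -> forall x, A x -> A x^-1.
Proof.
by move=> sA x Ax; rewrite -div1g; exact: subgroupF (subgroup1 sA) _.
Qed.

Lemma subgroupM {A} : subgroup A -> forall x y, A x -> A y -> A (x * y).
Proof.
move=> sA x y Ax Ay; rewrite -[y]invgK.
by apply: subgroupF => //; exact: subgroupV.
Qed.

Lemma subgroup_intro {A} :
  A 1 -> (forall x y, A x -> A y -> A (x / y)) -> subgroup A.
Proof.
move=> A1 AF; split=> [|x y /set_mem Ax /set_mem Ay]; apply/mem_set => //.
exact: AF.
Qed.

Lemma subgroup_generated A : subgroup (generated A).
Proof.
apply: subgroup_intro => [B [sB _]|x y Ax Ay B [sB AB]]; first exact: subgroup1.
by apply: subgroupF => //; [apply: Ax|apply: Ay].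
Qed.

Lemma sub_generated A : A `<=` generated A.
Proof. exact: sub_smallest. Qed.

Lemma generated_sub A B : subgroup B -> A `<=` B -> generated A `<=` B.
Proof. by move=> sB AB; exact: smallest_sub. Qed.

End Subgroups.

(** * The sixth root of unity *)

Section Eta.
Local Open Scope complex_scope.
Context {R : realType}.

(** [cos (pi / 3)] is a positive root of
    [4 c^3 - 3 c + 1 = (c + 1) (2 c - 1)^2], the triple-angle formula at
    [cos pi = -1]. *)
Lemma etaE : val (eta R) = 2^-1 +i* complex.Im (val (eta R)).
Proof.
rewrite /eta /= /expi /=; congr (_ +i* _).
set x := pi / 3.
have := @pi_gt0 R => pi0.
have c0 : 0 < cos x by apply: cos_gt0_pihalf; rewrite /x; lra.
have : cos (x *+ 2 + x) = -1.
  by rewrite (_ : x *+ 2 + x = pi) ?cospi // /x; field.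
rewrite cosD cos_mulr2n sin_mulr2n.
have := cos2Dsin2 x.
set c := cos x in c0 *; set s := sin x => cs.
rewrite (_ : _ - _ = 4 * c ^+ 3 - 3 * c); last first.
  have -> : (c * s) *+ 2 * s = 2 * c * s ^+ 2 by ring.
  by rewrite (_ : s ^+ 2 = 1 - c ^+ 2); [ring|rewrite -cs; ring].
move=> h; have {h} /eqP : (c + 1) * (2 * c - 1) ^+ 2 = 0.
  by rewrite (_ : _ * _ = 4 * c ^+ 3 - 3 * c + 1); [rewrite h addNr|ring].
rewrite mulf_eq0 expf_eq0 /= => /orP[] /eqP h; lra.
Qed.

Lemma Im_eta_gt0 : 0 < complex.Im (val (eta R)).
Proof.
by rewrite /eta /=; apply: sin_gt0_pi; have := @pi_gt0 R => pi0; lra.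
Qed.

Lemma Im_eta_sqr : complex.Im (val (eta R)) ^+ 2 = 3 / 4.
Proof.
have := cos2Dsin2 (pi / 3 : R).
have /(congr1 (@complex.Re R)) := etaE; rewrite /eta /= => ->.
by move=> h; lra.
Qed.

Local Notation eta := (val (eta R)).

Lemma eta_sqr : eta * eta = eta - 1.
Proof.
have := Im_eta_sqr; rewrite etaE /= => e2.
by congr (_ +i* _); lra.
Qed.

Lemma eta_neq1 : Defs.eta R <> 1%g.
Proof.
move/(congr1 (fun l : Cstar R => val l)) => h; have := Im_eta_gt0.
by rewrite h /= ltxx.
Qed.

Lemma val_cstarM (l n : Cstar R) : val (l * n)%g = val l * val n.
Proof. by []. Qed.

Lemma eta_cube : val (Defs.eta R * Defs.eta R * Defs.eta R)%g = -1.
Proof. by rewrite !val_cstarM eta_sqr mulrBl mul1r eta_sqr; ring. Qed.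

End Eta.

(** * Discrete subgroups of the line and of the plane *)

Lemma sub_closed_intmul {V : zmodType} {T : set V} :
  T 0 -> (forall x y, T x -> T y -> T (x - y)) ->
  forall x (k : int), T x -> T (x *~ k).
Proof.
move=> T0 TB x k Tx.
have Tn (n : nat) : T (x *+ n).
  elim: n => [|n IHn]; first by rewrite mulr0n.
  by rewrite mulrS -[_ *+ n]opprK; apply: (TB) => //; rewrite -sub0r; exact: TB.
case: k => n; first exact: Tn.
by rewrite NegzE mulrNz -sub0r; apply: (TB) => //; exact: Tn.
Qed.

(** Since two elements less than [eps] apart are equal, a positive element
    whose quotient by [eps] has least integer part is the least positive
    element. *)
Lemma discrete_subgroup_cyclic {R : realType} {T : set R} (eps : R) :
  T 0 -> (forall x y, T x -> T y -> T (x - y)) ->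
  0 < eps -> (forall t, T t -> `|t| < eps -> t = 0) ->
  (exists2 t, T t & t != 0) ->
  exists2 c, 0 < c & forall t, T t <-> exists k : int, t = k%:~R * c.
Proof.
move=> T0 TB e0 gap [t0 Tt0 t00].
pose P n := `[< exists t, [/\ T t, 0 < t & Num.truncn (t / eps) = n] >].
have exP : exists n, P n.
  have [t0p|t0n|/eqP] := ltrgtP t0 0; last by rewrite (negPf t00).
  - exists (Num.truncn (- t0 / eps)); apply/asboolP; exists (- t0); split => //.
      by rewrite -sub0r; exact: TB.
    by rewrite oppr_gt0.
  - by exists (Num.truncn (t0 / eps)); apply/asboolP; exists t0.
case: (ex_minnP exP) => n /asboolP[c [Tc c0 cn]] nmin.
exists c => // t; split; last first.
  by case=> k ->; rewrite mulrC mulrzr; exact: sub_closed_intmul.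
move=> Tt; exists (Num.floor (t / c)).
set k := Num.floor _.
have Tr : T (t - k%:~R * c).
  by apply: (TB) => //; rewrite mulrC mulrzr; exact: sub_closed_intmul.
have /andP[k1 k2] : k%:~R <= t / c < (k + 1)%:~R := floor_itv _.
have r0 : 0 <= t - k%:~R * c by rewrite subr_ge0 -ler_pdivlMr.
have rc : t - k%:~R * c < c.
  by move: k2; rewrite ltr_pdivrMr // rmorphD /= mulrDl mul1r => h; lra.
move: r0; rewrite le_eqVlt => /orP[/eqP/esym/eqP|r0].
  by rewrite subr_eq0 => /eqP.
(* A positive remainder would lie in the same [eps]-bin as [c]. *)
set r := t - _ in Tr rc r0.
have rn : (n <= Num.truncn (r / eps))%N.
  by apply: nmin; apply/asboolP; exists r.
have /gap : T (c - r) by exact: TB.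
have h1 : n%:R <= r / eps.
  by rewrite -truncn_ge_nat // divr_ge0 // ltW.
have h2 : c / eps < n.+1%:R.
  by rewrite -cn; exact: truncnS_gt.
move: h1 h2; rewrite ler_pdivlMr // ltr_pdivrMr // -natr1 mulrDl mul1r => h1 h2.
rewrite gtr0_norm ?subr_gt0 // => h.
by have := h ltac:(lra); lra.
Qed.

Section EisensteinLattice.
Local Open Scope complex_scope.
Context {R : realType}.
Local Notation C := (R[i]).
Local Notation eta := (val (eta R)).
Local Notation e := (complex.Im (val (Defs.eta R))).

(** The squared modulus takes values in [R], unlike the norm of [R[i]]. *)
Definition sqn (z : C) : R := complex.Re z ^+ 2 + complex.Im z ^+ 2.

Definition eis (m n : int) : C := m%:~R + n%:~R * eta.

Lemma intrC (n : int) : n%:~R = (n%:~R : R) +i* 0 :> C.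
Proof. by rewrite -[RHS]/((n%:~R : R)%:C) rmorph_int. Qed.

Lemma eisE m n : eis m n = (m%:~R + n%:~R / 2) +i* (n%:~R * e).
Proof.
by rewrite /eis !intrC etaE /=; congr (_ +i* _); ring.
Qed.

Lemma sqnM z w : sqn (z * w) = sqn z * sqn w.
Proof. by case: z w => [a b] [c d]; rewrite /sqn /=; ring. Qed.

Lemma sqn_ge0 z : 0 <= sqn z.
Proof. by rewrite addr_ge0 // sqr_ge0. Qed.

Lemma sqn_eq0 z : (sqn z == 0) = (z == 0).
Proof. by rewrite paddr_eq0 ?sqr_ge0 // !sqrf_eq0 eq_complex. Qed.

Lemma sqn_gt0 z : (0 < sqn z) = (z != 0).
Proof. by rewrite lt_def sqn_eq0 sqn_ge0 andbT. Qed.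

Lemma sqn1 : sqn 1 = 1.
Proof.
rewrite /sqn -[complex.Re 1]/(1 : R) -[complex.Im 1]/(0 : R).
by rewrite expr1n expr0n addr0.
Qed.

Lemma sqn_eta : sqn eta = 1.
Proof. by have := @Im_eta_sqr R; rewrite etaE /sqn /= => e2; lra. Qed.

(** Rounding the coordinates in the basis [1, eta] one after the other leaves
    an error of squared length at most [1/4 + 3/16]: [Z[eta]] is Euclidean. *)
Lemma eis_approx (u : C) : exists m n : int, sqn (u - eis m n) < 1.
Proof.
case: u => x y; have e0 := @Im_eta_gt0 R; have e2 := @Im_eta_sqr R.
pose n := Num.floor (y / e + 2^-1).
pose m := Num.floor (x - n%:~R / 2 + 2^-1).
exists m, n; rewrite eisE /sqn /=.
have /andP[] : m%:~R <= x - n%:~R / 2 + 2^-1 < (m + 1)%:~R := floor_itv _.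
have /andP[] : n%:~R <= y / e + 2^-1 < (n + 1)%:~R := floor_itv _.
rewrite !rmorphD /= -[1%:~R]/(1 : R).
set N : R := n%:~R; set M : R := m%:~R => n1 n2 m1 m2.
have -> : y - N * e = e * (y / e - N) by field; rewrite gt_eqF.
rewrite exprMn e2; set p := y / e - N; set q := x - (M + N / 2).
have : `|p| <= 2^-1 by rewrite ler_norml /p; lra.
have : `|q| <= 2^-1 by rewrite ler_norml /q; lra.
move=> /ler_normlP[q1 q2] /ler_normlP[p1 p2]; nra.
Qed.

(** Stability under [eta] makes [L] an ideal of the Euclidean ring [Z[eta]];
    since squared lengths are quantized by [d], there is a shortest nonzero
    vector, and division by it leaves no remainder. *)
Lemma eisenstein_ideal_principal (L : set C) (d : R) :
  L 0 -> (forall z w, L z -> L w -> L (z - w)) ->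
  (forall z, L z -> L (eta * z)) ->
  0 < d -> (forall z, L z -> exists k : int, sqn z = k%:~R * d) ->
  (exists2 z, L z & z != 0) ->
  exists2 a, a != 0 & forall z, L z <-> exists m n : int, z = a * eis m n.
Proof.
move=> L0 LB Leta d0 Ld [z0 Lz0 z00].
pose P n := `[< exists z, [/\ L z, z != 0 & sqn z = n%:R * d] >].
have Lnat z : L z -> exists n : nat, sqn z = n%:R * d.
  move=> /Ld[[k|k] zk]; first by exists k.
  have : 0 <= sqn z := sqn_ge0 z.
  rewrite zk pmulr_lge0 // NegzE rmorphN /= oppr_ge0 -pmulrn => h.
  by have := ltr0n R k.+1; rewrite ltNge h.
have [n0 z0n] := Lnat _ Lz0.
have exP : exists n, P n by exists n0; apply/asboolP; exists z0.
case: (ex_minnP exP) => n /asboolP[a [La a0 an]] nmin.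
have Leis m k : L (a * eis m k).
  rewrite /eis mulrDr mulrCA [_ * eta]mulrC [a * _]mulrC -![_%:~R * _]mulrC.
  rewrite [a * _]mulrC [_%:~R * a]mulrC !mulrzr -[X in _ + X]opprK.
  apply: (LB); first exact: (sub_closed_intmul L0 LB).
  rewrite -sub0r; apply: (LB) => //.
  by apply: (sub_closed_intmul L0 LB); exact: Leta.
exists a => // z; split; last by case=> m [k ->].
move=> Lz; have [m [k zmk]] := eis_approx (z / a).
exists m, k; apply/eqP; rewrite -subr_eq0; apply/negPn/negP => r0.
have Lr : L (z - a * eis m k) by exact: LB.
have [n1 rn1] := Lnat _ Lr.
have : (n <= n1)%N by apply: nmin; apply/asboolP; exists (z - a * eis m k).
apply/negP; rewrite -ltnNge -(@ltr_nat R) -(ltr_pM2r d0) -rn1 -an.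
rewrite (_ : z - _ = a * (z / a - eis m k)); last by field.
by rewrite sqnM gtr_pMr // sqn_gt0.
Qed.

End EisensteinLattice.

(** * Computations in the group *)

Section Computations.
Local Open Scope complex_scope.
Context {R : realType}.
Local Notation C := (R[i]).
Local Notation Re := (@complex.Re R).
Local Notation Im := (@complex.Im R).
Implicit Types (z w : C) (t s : R) (H : set (heis R)) (Gamma : set (heisC R)).

(** The element written [(z, t) mu(l)]; the ascription makes products of such
    triples use the semidirect law rather than that of a direct product. *)
Definition el z t (l : Cstar R) : heisC R := ((z, t), l).

Lemma heisM z t w s :
  (((z, t) : heis R) * ((w, s) : heis R))%g =
  (z + w, t + s + 2 * Im (z * w^*)) :> heis R.
Proof. by []. Qed.

Lemma heisV z t : (((z, t) : heis R)^-1)%g = (- z, - t) :> heis R.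
Proof. by []. Qed.

Lemma elM z t (l : Cstar R) w s (n : Cstar R) :
  (el z t l * el w s n)%g =
  el (z + val l * w) (t + sqn (val l) * s + 2 * Im (z * (val l * w)^*))
    (l * n)%g.
Proof. by rewrite /sqn -Re_sqr_norm. Qed.

Lemma inHE z t : inH (z, t) = el z t 1%g. Proof. by []. Qed.

Lemma elV z t : ((el z t 1%g)^-1)%g = el (- z) (- t) 1%g.
Proof.
apply/esym/(@mulgI _ (el z t 1%g)).
rewrite mulgV elM mulg1 /sqn /= expr0n expr1n.
case: z => a b /=; congr ((_ +i* _, _), _); ring.
Qed.

(** The translations in [Gamma], as elements of the Heisenberg group itself. *)
Definition Lam Gamma : set (heis R) := [set g | Gamma (inH g)].

Lemma inHM (g h : heis R) : inH (g * h)%g = (inH g * inH h)%g.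
Proof. by rewrite -[RHS]/((g * mu 1 h)%g, (1 * 1)%g) mu1 mulg1. Qed.

Lemma inHV (g : heis R) : inH (g^-1)%g = ((inH g)^-1)%g.
Proof. by apply: (@mulgI _ (inH g)); rewrite -inHM !mulgV. Qed.

Lemma subgroup_Lam {Gamma} : subgroup Gamma -> subgroup (Lam Gamma).
Proof.
move=> sG; apply: subgroup_intro => [|x y Lx Ly]; first exact: (subgroup1 sG).
by rewrite /Lam /= inHM inHV; exact: subgroupF.
Qed.

Lemma ImJ z w : Im (z * w^*) = Im z * Re w - Re z * Im w.
Proof. by case: z w => [a b] [c d] /=; ring. Qed.

Lemma heis_commg z t w s :
  [~ ((z, t) : heis R), ((w, s) : heis R)]%g = (0, 4 * Im (z * w^*)) :> heis R.
Proof.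
rewrite /commg /conjg !heisV !heisM !ImJ.
by case: z w => [a b] [c d] /=; congr (_ +i* _, _); ring.
Qed.

Lemma elM_axis z t (l : Cstar R) r (n : Cstar R) :
  (el z t l * el 0 r n)%g = el z (t + sqn (val l) * r) (l * n)%g.
Proof.
rewrite elM !mulr0 ImJ [Im 0]/= [Re 0]/= !mulr0 subrr mulr0.
by rewrite !addr0.
Qed.

Lemma centralM t z s : (el 0 t 1 * el z s 1)%g = el z (t + s) 1%g.
Proof.
rewrite elM mulg1 ImJ /sqn /el; case: z => a b /=.
by congr ((_ +i* _, _), _); ring.
Qed.

Lemma heis_scale {H} z t (k : int) :
  subgroup H -> H (z, t) -> H (k%:~R * z, k%:~R * t).
Proof.
move=> sH Hz.
have Hn (n : nat) : H (n%:R * z, n%:R * t).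
  elim: n => [|n IHn]; first by rewrite !mul0r; exact: (subgroup1 sH).
  have := subgroupM sH _ _ Hz IHn; rewrite heisM ImJ.
  rewrite (_ : (_, _) = (n.+1%:R * z, n.+1%:R * t)) // -!natr1.
  have -> : (n%:R : C) = (n%:R : R)%:C by rewrite rmorph_nat.
  by case: z {Hz IHn} => a b /=; congr (_ +i* _, _); ring.
case: k => n; first exact: Hn.
rewrite NegzE !rmorphN /= !mulNr; exact: (subgroupV sH _ (Hn n.+1)).
Qed.

(** [Gamma] normalizes its translations; this is the conjugate of [(z, t)] by
    [(w, s) mu(l)]. *)
Lemma rotation {Gamma} w s l z t : subgroup Gamma ->
  Gamma (el w s l) -> Gamma (el z t 1%g) ->
  Gamma (el (val l * z) (sqn (val l) * t + 4 * Im (w * (val l * z)^*)) 1%g).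
Proof.
move=> sG Gw Gz.
have := subgroupF sG _ _ (subgroupM sG _ _ Gw Gz) Gw.
congr Gamma; apply: (canLR (mulgK _)).
rewrite !elM mulg1 mul1g !ImJ; case: (val l) w z {Gw Gz} => [l1 l2] [a b] [c d].
by rewrite /sqn /=; congr ((_ +i* _, _), _); ring.
Qed.

(** The cube of an element over [eta] lies over [-1], hence its sixth power
    is vertical. *)
Lemma exists_vertical {Gamma} w s :
  subgroup Gamma -> torsion_free Gamma -> Gamma (el w s (Defs.eta R)) ->
  exists2 t, Gamma (el 0 t 1%g) & t != 0.
Proof.
move=> sG tfG Gg; set g := el _ _ _ in Gg.
set g3 := (g * g * g)%g.
have Gg3 : Gamma g3 by do !apply: subgroupM => //.
have [u [r g3E]] : exists u r,
    g3 = el u r (Defs.eta R * Defs.eta R * Defs.eta R)%g.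
  by rewrite /g3 /g !elM; eexists; eexists.
have g6E : (g3 * g3)%g = el 0 (2 * r) 1%g.
  rewrite g3E elM eta_cube ImJ /el; congr ((_, _), _).
  - by ring.
  - by case: u {g3E} => a b; rewrite /sqn /=; ring.
  - by apply: val_inj; rewrite val_cstarM eta_cube mulN1r opprK.
exists (2 * r); first by rewrite -g6E; exact: subgroupM.
apply/eqP => r0; apply: (@eta_neq1 R).
have : g = 1%g.
  apply: (tfG _ 6%N) => //.
  rewrite (_ : (g ^+ 6)%g = (g3 * g3)%g); first by rewrite g6E r0.
  by rewrite !expgS expg0 mulg1 /g3 !mulgA.
by move/(congr1 snd).
Qed.

End Computations.

(** * Discreteness and cocompactness *)

Section Topology.
Local Open Scope complex_scope.
Local Open Scope quotient_scope.
Context {R : realType}.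
Local Notation C := (R[i]).
Local Notation Re := (@complex.Re R).
Implicit Types (z w : C) (t s : R) (Gamma : set (heisC R)).

Lemma vertical_gap {Gamma} : subgroup Gamma -> Gamma `<=` isolated Gamma ->
  exists2 eps, 0 < eps & forall t, Gamma (el 0 t 1%g) -> `|t| < eps -> t = 0.
Proof.
move=> sG dG; have [_ [V V1 VG]] := dG _ (subgroup1 sG).
have [[A B] /= [A1 B1] AB] := V1.
have [[A' B'] /= [A'1 B'1] AB'] := A1.
have [eps /= e0 beps] := (@nbhs_ballP _ _ _ _).1 B'1.
exists eps => // t Gt te.
have : (V `&` Gamma) (el 0 t 1%g).
  split=> //; apply: AB; split; last exact: (nbhs_singleton B1).
  apply: AB'; split; first exact: (nbhs_singleton A'1).
  by apply: beps; rewrite /ball /= sub0r normrN.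
by rewrite VG => -[].
Qed.

Lemma continuous_Re : continuous (Re : C -> R).
Proof.
move=> z A /nbhs_ballP[eps /= e0 epsA]; apply/nbhs_ballP.
exists eps%:C => /=; first by rewrite ltcR.
move=> w zw; apply: epsA; rewrite /ball /= -ltcR; apply: le_lt_trans zw.
rewrite (_ : Re z - Re w = Re (z - w)) ?normc_ge_Re //.
by case: z w => [a b] [c d].
Qed.

(** The distance to the vertical axis over [z0] would be an invariant
    continuous function, hence bounded on a compact quotient, although it is
    unbounded on the Heisenberg group. *)
Lemma not_axis_stabilizer {Gamma} (sG : subgroup Gamma) z0 :
  compact [set: orbit_space sG] ->
  ~ (forall w s l, Gamma (el w s l) -> sqn (val l) = 1 /\ w + val l * z0 = z0).
Proof.
move=> cG fixz0.
pose f (h : heis R) : R := Re `|h.1 - z0|.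
have cf : continuous f.
  have c1 : continuous (fun h : heis R => (h.1 : C) - z0).
    move=> h; apply: (@cvgB _ C); last exact: cvg_cst.
    exact: cvg_fst.
  have c2 : continuous (fun h : heis R => `|(h.1 : C) - z0|).
    move=> h; exact: (continuous_comp (c1 h) (@norm_continuous _ C (h.1 - z0))).
  move=> h; exact: (continuous_comp (c2 h) (@continuous_Re `|h.1 - z0|)).
pose Q := quotient_topology {eq_quot (orbit_equiv sG)}.
have finv (h k : heis R) : \pi_Q h == \pi_Q k -> f h == f k.
  move/eqP/eqquotP => /asboolP[[[w s] l] Gx ->].
  have [l1 wl] := fixz0 _ _ _ Gx.
  have -> : f (act (w, s, l) h) = Re `|val l * (h.1 - z0)|.
    congr (Re `|_|); rewrite -[in LHS]wl -[(act _ _).1]/(w + val l * h.1); ring.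
  rewrite normrM (_ : `|val l| = 1) ?mul1r //.
  by apply/eqP; rewrite -(@eqrXn2 _ 2) // expr1n -add_Re2_Im2 -/(sqn _) l1.
have cF : continuous (f \o repr : Q -> R) := repr_comp_continuous cf finv.
have /compact_bounded[M [_ bM]] :=
  continuous_compact (continuous_subspaceT cF) cG.
pose h : heis R := (z0 + (`|M| + 2)%:C, 0).
have M2 : 0 <= `|M| + 2 by rewrite addr_ge0.
have fh : f h = `|M| + 2.
  rewrite /f (_ : h.1 - z0 = (`|M| + 2)%:C); last by rewrite addrAC subrr add0r.
  rewrite normc_def /= expr0n addr0 sqrtr_sqr.
  exact: ger0_norm.
have : `|f h| <= M + 1.
  apply: (bM (M + 1)); rewrite ?ltrDl //; exists (\pi_Q h) => //=.
  by apply/eqP/finv; rewrite reprK.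
by rewrite fh ger0_norm //; have := ler_norm M; lra.
Qed.

End Topology.

(** * The shape of the lattice *)

Section Lattice.
Local Open Scope complex_scope.
Context {R : realType}.
Local Notation C := (R[i]).
Local Notation Im := (@complex.Im R).
Local Notation eta := (val (eta R)).
Local Notation e := (complex.Im (val (Defs.eta R))).
Implicit Types (z w a : C) (t s c : R) (Gamma : set (heisC R)).

Definition vertical_period Gamma c : Prop :=
  forall t, Gamma (el 0 t 1%g) <-> exists k : int, t = k%:~R * c.

Definition horizontal_ideal Gamma a : Prop :=
  forall z, (exists t, Gamma (el z t 1%g)) <-> exists m n, z = a * eis m n.

Lemma exists_vertical_period {Gamma} w s :
  subgroup Gamma -> Gamma `<=` isolated Gamma -> torsion_free Gamma ->
  Gamma (el w s (Defs.eta R)) -> exists2 c, 0 < c & vertical_period Gamma c.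
Proof.
move=> sG dG tfG Gg; have [eps e0 gap] := vertical_gap sG dG.
apply: (discrete_subgroup_cyclic (T := fun t => Gamma (el 0 t 1%g)) eps) => //.
- exact: (subgroup1 sG).
- move=> x y Gx Gy; have := subgroupF sG _ _ Gx Gy; rewrite elV elM mulg1 ImJ.
  by congr (Gamma (el _ _ _)); rewrite /sqn /=; ring.
- exact: exists_vertical Gg.
Qed.

Lemma mulJ_eta z : Im (z * (eta * z)^*) = - (e * sqn z).
Proof. by rewrite ImJ etaE /sqn; case: z => x y /=; field. Qed.

Lemma lattice_commg {Gamma} z t w s : subgroup Gamma ->
  Gamma (el z t 1%g) -> Gamma (el w s 1%g) ->
  Gamma (el 0 (4 * Im (z * w^*)) 1%g).
Proof.
move=> sG Gz Gw; have sL := subgroup_Lam sG.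
rewrite -inHE -(heis_commg z t w s) /commg /conjg.
change (Lam Gamma (((z, t) : heis R)^-1 *
  (((w, s) : heis R)^-1 * (((z, t) : heis R) * ((w, s) : heis R))))%g).
by do ?[apply: (subgroupM sL) | apply: (subgroupV sL)].
Qed.

(** The commutator of lifts of [z] and [eta z] has height [- 4 e |z|^2],
    which quantizes the squared lengths. *)
Lemma exists_horizontal_ideal {Gamma} w0 s0 c :
  subgroup Gamma -> Gamma (el w0 s0 (Defs.eta R)) ->
  0 < c -> vertical_period Gamma c ->
  (exists z t, Gamma (el z t 1%g) /\ z != 0) ->
  exists2 a, a != 0 & horizontal_ideal Gamma a.
Proof.
move=> sG Gg c0 Gc [z1 [t1 [Gz1 z10]]].
have e0 := @Im_eta_gt0 R.
apply: (eisenstein_ideal_principal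
  (fun z => exists t, Gamma (el z t 1%g)) (c / (4 * e))).
- by exists 0; exact: (subgroup1 sG).
- move=> z w [t Gz] [s Gw]; have := subgroupF sG _ _ Gz Gw.
  rewrite elV elM mulg1.
  by rewrite [val _]/= mul1r => ?; eexists; eassumption.
- move=> z [t Gz]; have := rotation _ _ _ _ _ sG Gg Gz.
  by exists (sqn eta * t + 4 * Im (w0 * (eta * z)^*)).
- by rewrite divr_gt0 // mulr_gt0.
- move=> z [t Gz].
  have := lattice_commg _ _ _ _ sG Gz (rotation _ _ _ _ _ sG Gg Gz).
  move=> /Gc[k]; rewrite mulJ_eta => h; exists (- k).
  rewrite rmorphN /= mulrA (_ : - k%:~R * c = 4 * e * sqn z); last by lra.
  by rewrite [_ * sqn z]mulrC mulfK // gt_eqF // mulr_gt0.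
- by exists z1 => //; exists t1.
Qed.

(** If all translations in [Gamma] were vertical, commutators would act
    trivially on the plane, so every element of [Gamma] would commute there
    with the rotation over [eta] and fix its center. *)
Lemma exists_horizontal {Gamma} w0 s0 :
  heisenberg_bieberbach Gamma -> Gamma (el w0 s0 (Defs.eta R)) ->
  exists z t, Gamma (el z t 1%g) /\ z != 0.
Proof.
case=> sG uG _ _ cG Gg.
have [//|nex] := pselect (exists z t, Gamma (el z t 1%g) /\ z != 0).
have hor0 z t : Gamma (el z t 1%g) -> z = 0.
  by move=> Gz; apply/eqP/negPn/negP => z0; apply: nex; exists z, t.
have eta1 : 1 - eta != 0.
  apply/eqP => h; apply: (@eta_neq1 R); apply: val_inj.
  exact: (esym (subr0_eq h)).
case: (not_axis_stabilizer sG (w0 / (1 - eta)) cG) => w s l Gx.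
split.
  have := uG _ Gx; rewrite /pr2 /= => l1.
  by rewrite /sqn -Re_sqr_norm l1 expr1n.
(* A commutator in [Gamma] is a translation, hence vertical by assumption. *)
set v := (el w0 s0 (Defs.eta R) * el w s l /
          (el w s l * el w0 s0 (Defs.eta R)))%g.
have Gv : Gamma v by apply: (subgroupF sG); exact: (subgroupM sG).
have : (v * (el w s l * el w0 s0 (Defs.eta R)) =
        el w0 s0 (Defs.eta R) * el w s l)%g.
  by rewrite mulgVK.
case: v Gv => -[u r] n Gv; rewrite -/(el u r n) !elM => vE.
have n1 : n = 1%g.
  apply: (@mulIg _ (l * Defs.eta R)%g); rewrite mul1g.
  rewrite [LHS](congr1 snd vE); apply: val_inj; exact: mulrC.
have : u + val n * (w + val l * w0) = w0 + eta * w.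
  exact: (congr1 (fun x : heisC R => x.1.1) vE).
rewrite n1 in Gv *; rewrite (hor0 _ _ Gv) [val _]/(1 : C) mul1r add0r => h.
apply: (mulIf eta1); rewrite mulrDl -mulrA divfK //.
rewrite (_ : w * _ = w + val l * w0 - val l * w0 - eta * w); last by ring.
by rewrite h; ring.
Qed.

End Lattice.

(** * The index of the derived subgroup in the center *)

Section Index.
Local Open Scope complex_scope.
Context {R : realType}.
Local Notation C := (R[i]).
Local Notation Im := (@complex.Im R).
Local Notation e := (complex.Im (val (Defs.eta R))).
Implicit Types (z w a : C) (t s c : R) (Gamma : set (heisC R)).

Lemma form_eis a (m n m' n' : int) :
  Im ((a * eis m n) * (a * eis m' n')^*) = sqn a * e * (n * m' - m * n')%:~R.
Proof.
rewrite ImJ !eisE rmorphB !rmorphM /sqn; set x := e.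
by case: a => a1 a2 /=; field.
Qed.

Lemma commute_form z t w s :
  commute (el z t 1%g) (el w s 1%g) -> Im (z * w^*) = 0.
Proof.
move=> /(congr1 (fun x : heisC R => x.1.2)).
rewrite !elM !ImJ /= /sqn /=; case: z w => [a b] [c d] /= h; lra.
Qed.

Lemma subgroup_vertical_multiples (d : R) :
  subgroup (range (fun k : int => el 0 (k%:~R * d) 1%g)).
Proof.
apply: subgroup_intro; first by exists 0 => //; rewrite mul0r.
move=> _ _ [j _ <-] [k _ <-]; exists (j - k) => //.
by rewrite elV oppr0 centralM rmorphB /= mulrBl.
Qed.

Section LambdaIndex.
Context {Gamma : set (heisC R)} {a : C} {c : R}.
Hypotheses (sG : subgroup Gamma) (a0 : a != 0) (c0 : 0 < c).
Hypotheses (Gc : vertical_period Gamma c) (Ga : horizontal_ideal Gamma a).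
Let Lambda := Gamma `&` range (@inH R).
Let D := 4 * (sqn a * e).

Lemma LambdaP z t : Lambda (el z t 1%g) <-> Gamma (el z t 1%g).
Proof. by split=> [[]//|Gz]; split=> //; exists (z, t). Qed.

(** The symplectic form is nondegenerate on [a Z[eta]]: pairing with [a] and
    [a eta] recovers both coordinates. *)
Lemma center_Lambda :
  group_center Lambda = range (fun k : int => el 0 (k%:~R * c) 1%g).
Proof.
apply/seteqP; split=> [x [[Gx [[z t] _ xE]] xC]|_ [k _ <-]].
  subst x; rewrite inHE in Gx xC *.
  have /Ga[m [n zE]] : exists t, Gamma (el z t 1%g) by exists t.
  have form0 m' n' : (n * m' - m * n')%:~R = 0 :> R.
    have [t' Gt'] : exists t, Gamma (el (a * eis m' n') t 1%g).
      by apply/Ga; exists m', n'.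
    have /xC/commute_form : Lambda (el (a * eis m' n') t' 1%g) by apply/LambdaP.
    rewrite zE form_eis => /eqP; rewrite mulf_eq0 => /orP[|/eqP//].
    by rewrite gt_eqF // mulr_gt0 ?Im_eta_gt0 // sqn_gt0.
  have /eqP := form0 1 0; rewrite intr_eq0 mulr1 mulr0 subr0 => /eqP n0.
  have /eqP := form0 0 1.
  rewrite intr_eq0 mulr1 mulr0 sub0r oppr_eq0 => /eqP m0.
  have z0 : z = 0 by rewrite zE n0 m0 /eis mul0r addr0 mulr0.
  by rewrite z0 in Gx *; have /Gc[k ->] := Gx; exists k.
split; first by apply/LambdaP/Gc; exists k.
move=> _ [_ [[w s] _ <-]].
rewrite /commute inHE centralM elM mulg1 /el /sqn ImJ.
by case: w => u v; congr ((_ +i* _, _), _) => /=; ring.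
Qed.

(** The form takes values in [|a|^2 e Z] and reaches its generator at [a eta]
    and [a]. *)
Lemma derived_Lambda :
  derived Lambda = range (fun k : int => el 0 (k%:~R * D) 1%g).
Proof.
have inHR (g h : heis R) : [~ inH g, inH h]%g = inH [~ g, h]%g.
  by rewrite /commg /conjg -!inHV -!inHM.
apply/seteqP; split.
  apply: generated_sub; first exact: subgroup_vertical_multiples.
  move=> _ [x [Gx [[z t] _ xE]]] [y [Gy [[w s] _ yE]] <-]; subst x y.
  rewrite inHR heis_commg.
  have /Ga[m [n ->]] : exists t, Gamma (el z t 1%g) by exists t.
  have /Ga[m' [n' ->]] : exists t, Gamma (el w t 1%g) by exists s.
  exists (n * m' - m * n') => //.
  by rewrite form_eis /D; congr (el _ _ _); ring.
move=> _ [k _ <-].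
have sD : subgroup (Lam (derived Lambda)).
  by apply: subgroup_Lam; exact: subgroup_generated.
suff : Lam (derived Lambda) (0, D) by move/(heis_scale _ _ k sD); rewrite mulr0.
have [t Gt] : exists t, Gamma (el (a * eis 0 1) t 1%g).
  by apply/Ga; exists 0, 1.
have [s Gs] : exists t, Gamma (el (a * eis 1 0) t 1%g).
  by apply/Ga; exists 1, 0.
apply: sub_generated; exists (el (a * eis 0 1) t 1%g); first exact/LambdaP.
exists (el (a * eis 1 0) s 1%g); first exact/LambdaP.
rewrite -!inHE inHR heis_commg form_eis /D; congr (el _ _ _); ring.
Qed.

(** If [D = M c], the cosets of [D Z] in [c Z] are represented by the
    multiples of [c] with factors from [0] to [M - 1]. *)
Lemma lattice_index N :
  lcosets (group_center Lambda) (derived Lambda) #= `I_N -> N%:R * c = D.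
Proof.
have D0 : 0 < D by rewrite !mulr_gt0 ?Im_eta_gt0 // sqn_gt0.
have [M DM] : exists M : nat, D = M%:R * c.
  have [t Gt] : exists t, Gamma (el (a * eis 0 1) t 1%g).
    by apply/Ga; exists 0, 1.
  have [s Gs] : exists t, Gamma (el (a * eis 1 0) t 1%g).
    by apply/Ga; exists 1, 0.
  have /Gc[[k|k]] := lattice_commg _ _ _ _ sG Gt Gs; rewrite form_eis => DE.
    by exists k; rewrite /D -DE; ring.
  suff : D < 0 by rewrite ltNge ltW.
  rewrite (_ : D = (Negz k)%:~R * c); last by rewrite -DE /D; ring.
  by rewrite NegzE rmorphN mulNr oppr_lt0 mulr_gt0 // ltr0n.
have M0 : (0 < M)%N.
  by rewrite lt0n; apply/eqP => M0; move: D0; rewrite DM M0 mul0r ltxx.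
pose F (i : nat) : set (heisC R) :=
  range (fun k : int => el 0 ((i%:Z + k * M%:Z)%:~R * c) 1%g).
have FE : lcosets (group_center Lambda) (derived Lambda) = F @` `I_M.
  have cosetE (j k : int) :
      (el 0 (j%:~R * c) 1 * el 0 (k%:~R * D) 1)%g =
      el 0 ((j + k * M%:Z)%:~R * c) 1%g.
    rewrite centralM DM; congr (el _ _ _).
    by rewrite rmorphD rmorphM /= -pmulrn; ring.
  rewrite center_Lambda derived_Lambda; apply/seteqP; split=> A.
    case=> _ [j _ <-] <-.
    exists `|(j %% M)%Z|%N => /=.
      by rewrite -ltz_nat gez0_abs ?modz_ge0 ?ltz_pmod // -?lt0n; lia.
    have jM : j = (j %/ M)%Z * M%:Z + `|(j %% M)%Z|%N%:Z.
      by rewrite gez0_abs ?modz_ge0 -?divz_eq //; lia.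
    apply/seteqP; split=> [_ [k _ <-]|_ [_ [k _ <-] <-]].
      exists (el 0 ((k - (j %/ M)%Z)%:~R * D) 1%g).
        by exists (k - (j %/ M)%Z).
      by rewrite cosetE; congr (el _ (_%:~R * _) _); lia.
    exists (k + (j %/ M)%Z) => //.
    by rewrite cosetE; congr (el _ (_%:~R * _) _); lia.
  case=> i iM <-; exists (el 0 (i%:~R * c) 1%g); first by exists i.
  apply/seteqP; split=> [_ [_ [k _ <-] <-]|_ [k _ <-]].
    by exists k; rewrite // cosetE.
  by exists (el 0 (k%:~R * D) 1%g); [exists k|rewrite cosetE].
have Finj : {in `I_M &, injective F}.
  move=> i j; rewrite !inE /= => iM jM Fij.
  have : F j (el 0 ((i%:Z + 0 * M%:Z)%:~R * c) 1%g) by rewrite -Fij; exists 0.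
  move=> [k _] /(congr1 (fun x : heisC R => x.1.2)) /= /(mulIf (lt0r_neq0 c0)).
  move=> /intr_inj; rewrite mul0r addr0 => ij.
  have : k = 0 by nia.
  lia.
by rewrite FE (card_eql (inj_card_eq Finj)) => /card_eq_II <-.
Qed.

End LambdaIndex.
End Index.

(** * Conjugation to the standard position *)

Section Conjugation.
Local Open Scope complex_scope.
Context {R : realType}.
Local Notation C := (R[i]).
Local Notation Re := (@complex.Re R).
Local Notation Im := (@complex.Im R).
Local Notation eta := (val (eta R)).
Implicit Types (z w a : C) (t s c : R) (Gamma : set (heisC R)).

Definition conj_by (g : heisC R) Gamma : set (heisC R) :=
  [set x | Gamma (g * x * g^-1)%g].

Lemma conjugate_conj_by g Gamma K : conj_by g Gamma = K -> conjugate Gamma K.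
Proof.
move=> <-; exists g; apply/seteqP; split=> [x Gx|_ [x Gx <-]//].
exists (g^-1 * x * g)%g; last by rewrite !mulgA mulgV mul1g mulgK.
by rewrite /conj_by /= !mulgA mulgV mul1g mulgK.
Qed.

Lemma subgroup_conj_by g Gamma : subgroup Gamma -> subgroup (conj_by g Gamma).
Proof.
move=> sG; apply: subgroup_intro => [|x y Gx Gy].
  by rewrite /conj_by /= mulg1 mulgV; exact: subgroup1.
have := subgroupF sG _ _ Gx Gy; rewrite /conj_by /=; congr Gamma.
by rewrite !invgM invgK !mulgA mulgVK.
Qed.

Lemma conj_by_torsion_free g Gamma :
  torsion_free Gamma -> torsion_free (conj_by g Gamma).
Proof.
move=> tfG x n Gx n0 xn.
have cX : ((g * x * g^-1) ^+ n = g * x ^+ n * g^-1)%g.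
  elim: (n) => [|m IHm]; first by rewrite !expg0 mulg1 mulgV.
  by rewrite !expgS IHm !mulgA mulgVK.
have := tfG _ n Gx n0; rewrite cX xn mulg1 mulgV => /(_ erefl) h.
apply: (@mulgI _ g); apply: (@mulIg _ (g^-1)%g).
by rewrite h mulg1 mulgV.
Qed.

Lemma conj_by_el1 z0 (a : Cstar R) z t Gamma :
  conj_by (el z0 0 a) Gamma (el z t 1%g) <->
  Gamma (el (val a * z) (sqn (val a) * t + 4 * Im (z0 * (val a * z)^*)) 1%g).
Proof.
rewrite /conj_by /=; set x := (_ / _)%g; set y := el _ _ _.
suff -> : x = y by [].
apply: (canLR (mulgK _)); rewrite /y !elM mulg1 mul1g /el !ImJ.
case: a z z0 {x y} => [[a1 a2] a0] [x y] [x0 y0].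
by rewrite /sqn /=; congr ((_ +i* _, _), _); ring.
Qed.

Lemma conj_by_period z0 (a : Cstar R) c Gamma :
  vertical_period Gamma c ->
  vertical_period (conj_by (el z0 0 a) Gamma) (c / sqn (val a)).
Proof.
move=> Gc t; have a0 : sqn (val a) != 0 by rewrite sqn_eq0 (valP a).
have -> : conj_by (el z0 0 a) Gamma (el 0 t 1%g) <->
    Gamma (el 0 (sqn (val a) * t) 1%g).
  by rewrite conj_by_el1 mulr0 ImJ [Im 0]/= [Re 0]/= !mulr0 subrr mulr0 addr0.
rewrite (Gc _); split=> -[k kE]; exists k.
  by rewrite mulrA -kE mulrC mulKf.
by rewrite kE; field.
Qed.

Lemma conj_by_ideal z0 (a : Cstar R) Gamma :
  horizontal_ideal Gamma (val a) ->
  horizontal_ideal (conj_by (el z0 0 a) Gamma) 1.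
Proof.
move=> Ga z; have a0 := valP a; have sa0 : sqn (val a) != 0 by rewrite sqn_eq0.
split=> [[t] /conj_by_el1 Gt|[m [n ->]]].
  have /Ga[m [n zE]] : exists t, Gamma (el (val a * z) t 1%g).
    by eexists; exact: Gt.
  by exists m, n; rewrite mul1r; exact: (mulfI a0).
have [t Gt] : exists t, Gamma (el (val a * eis m n) t 1%g).
  by apply/Ga; exists m, n.
exists ((t - 4 * Im (z0 * (val a * eis m n)^*)) / sqn (val a)).
by apply/conj_by_el1; rewrite mul1r [sqn _ * _]mulrC divfK // subrK.
Qed.

(** [w / (1 - eta)] is the fixed point of the planar motion
    [z |-> w + eta z]. *)
Lemma conj_by_rotation w s (a : Cstar R) Gamma :
  Gamma (el w s (Defs.eta R)) ->
  exists s', conj_by (el (w / (1 - eta)) 0 a) Gamma (el 0 s' (Defs.eta R)).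
Proof.
move=> Gg; set z0 := w / _.
have a0 : sqn (val a) != 0 by rewrite sqn_eq0 (valP a).
(* The numerator is the height of [(w, s) mu(eta) (z0, 0)]. *)
exists ((s + 2 * Im (w * (eta * z0)^*)) / sqn (val a)).
rewrite /conj_by /=; set x := (_ / _)%g.
suff -> : x = el w s (Defs.eta R) by [].
apply: (canLR (mulgK _)); rewrite !elM.
have -> : w + eta * z0 = z0.
  rewrite /z0; field; apply/eqP => h; apply: (@eta_neq1 R); apply: val_inj.
  exact: (esym (subr0_eq h)).
have -> : (a * Defs.eta R = Defs.eta R * a)%g by apply: val_inj; exact: mulrC.
have I0 : Im (z0 * 0^*) = 0 by rewrite ImJ /= !mulr0 subrr.
rewrite !mulr0 I0 mulr0 !addr0 add0r [sqn _ * _]mulrC divfK //.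
Qed.

End Conjugation.

(** * Classification in standard position *)

Section StandardPosition.
Local Open Scope complex_scope.
Context {R : realType}.
Local Notation C := (R[i]).
Local Notation Re := (@complex.Re R).
Local Notation Im := (@complex.Im R).
Local Notation eta := (val (eta R)).
Local Notation e := (complex.Im (val (Defs.eta R))).
Implicit Types (z w a : C) (t s c : R).

Context {G : set (heisC R)} {N : nat} {s : R}.
Let c := 4 * e / N%:R.
Hypotheses (sG : subgroup G) (tfG : torsion_free G).
Hypothesis prG : forall x, G x -> generated [set Defs.eta R] (pr2 x).
Hypothesis N0 : (0 < N)%N.
Hypotheses (Gc : vertical_period G c) (G1 : horizontal_ideal G 1).
Hypothesis (Geta : G (el 0 s (Defs.eta R))).

Let c0 : 0 < c.
Proof. by rewrite divr_gt0 ?mulr_gt0 ?Im_eta_gt0 // ltr0n. Qed.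

Let eN : 4 * e = N%:R * c.
Proof. by rewrite /c [RHS]mulrC divfK // pnatr_eq0 -lt0n. Qed.

Lemma vertical_shift z t k : G (el z t 1%g) -> G (el z (t + k%:~R * c) 1%g).
Proof.
move=> Gz; have Gk : G (el 0 (k%:~R * c) 1%g) by apply/Gc; exists k.
by have := subgroupM sG _ _ Gk Gz; rewrite centralM addrC.
Qed.

(** Modulo the right-hand side, an element of [G] becomes a translation, and
    the translations in [G] are generated by lifts of [1] and [eta] together
    with the period [c]. *)
Lemma eq_generated_psi s' :
  G (psi s') -> G (el 1 0 1%g) -> G (el eta 0 1%g) ->
  G = generated (@inH R @` Lambda_std eta c `|` [set psi s']).
Proof.
move=> Gpsi Ga Gb; set K := generated _.
have sK : subgroup K := subgroup_generated _.
have stdG : Lambda_std eta c `<=` Lam G.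
  apply: generated_sub; first exact: subgroup_Lam.
  move=> h [[->|->]|->] //; rewrite /Lam /= inHE.
  by apply/Gc; exists 1; rewrite mul1r.
have KG : K `<=` G.
  by apply: generated_sub => // _ [[g /stdG Lg <-]|-> //].
apply/seteqP; split=> // x Gx.
have [y Ky yx] : exists2 y, K y & pr2 y = pr2 x.
  have := prG _ Gx; apply: (generated_sub _ (@pr2 R @` K)).
    apply: subgroup_intro; first by exists 1%g; first exact: subgroup1.
    move=> _ _ [u Ku <-] [v Kv <-].
    by exists (u / v)%g; first exact: (subgroupF sK _ _ Ku Kv).
  by move=> _ ->; exists (psi s') => //; apply: sub_generated; right.
have Gv : G (x / y)%g by apply: (subgroupF sG) => //; exact: KG.
suff Kv : K (x / y)%g.
  by rewrite -[x](mulgVK y); exact: (subgroupM sK _ _ Kv Ky).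
have [z [t vE]] : exists z t, (x / y)%g = el z t 1%g.
  have : (x / y)%g.2 = 1%g by rewrite -[LHS]/(pr2 x / pr2 y)%g yx mulgV.
  by case: (x / y)%g => -[z t] l /= ->; exists z, t.
rewrite {}vE in Gv *.
have [m [n zE]] : exists m n, z = 1 * eis m n by apply/G1; exists t.
have sL : subgroup (Lambda_std eta c) := subgroup_generated _.
suff Lz : Lambda_std eta c (z, t) by apply: sub_generated; left; exists (z, t).
have La : Lambda_std eta c (1, 0) by apply: sub_generated; left; left.
have Lb : Lambda_std eta c (eta, 0) by apply: sub_generated; left; right.
have Lc : Lambda_std eta c (0, c) by apply: sub_generated; right.
have [r Lr] : exists r, Lambda_std eta c (z, r).
  have := subgroupM sL _ _ (heis_scale _ _ m sL La) (heis_scale _ _ n sL Lb).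
  by rewrite heisM mulr1 -/(eis m n) -[eis m n]mul1r -zE; eexists; eassumption.
have /Gc[k kE] : G (el 0 (t - r) 1%g).
  have := subgroupF sG _ _ Gv (stdG _ Lr : G (el z r 1%g)).
  rewrite elV elM mulg1 ImJ.
  congr (G (el _ _ _)); case: (z) => u v; rewrite /sqn /=.
    by congr (_ +i* _); ring.
  by ring.
have := subgroupM sL _ _ (heis_scale _ _ k sL Lc) Lr.
rewrite heisM mulr0 add0r -kE ImJ [Im 0]/= [Re 0]/= !mul0r subrr mulr0 addr0.
by rewrite subrK.
Qed.

Lemma rotate z t : G (el z t 1%g) -> G (el (eta * z) t 1%g).
Proof.
move=> Gz; have := rotation _ _ _ _ _ sG Geta Gz.
by rewrite sqn_eta mul1r ImJ [Im 0]/= [Re 0]/= !mul0r subrr mulr0 addr0.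
Qed.

(** Rotating a lift of [1] twice gives a lift of [eta^2] of the same height,
    while dividing a lift of [eta] by it gives a lift of [eta - 1] of height
    [- 2 e]; the two differ by a vertical period. *)
Lemma horizontal_height : exists j : int, G (el 1 (j%:~R * c - 2 * e) 1%g).
Proof.
have [t Gt] : exists t, G (el 1 t 1%g).
  by apply/G1; exists 1, 0; rewrite /eis mul0r addr0 mulr1.
have Geta1 := rotate _ _ Gt; have Geta2 := rotate _ _ Geta1.
have Gd : G (el (eta - 1) (- (2 * e)) 1%g).
  have := subgroupF sG _ _ Geta1 Gt; rewrite elV elM mulg1 ImJ.
  rewrite etaE /sqn; congr (G (el _ _ _)) => /=; first by congr (_ +i* _); ring.
  by ring.
have /Gc[j jE] : G (el 0 (t + 2 * e) 1%g).
  have := subgroupF sG _ _ Geta2 Gd; rewrite elV elM mulg1 ImJ mulr1 eta_sqr.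
  rewrite etaE /sqn; congr (G (el _ _ _)) => /=; first by congr (_ +i* _); ring.
  by ring.
by exists j; rewrite -jE addrK.
Qed.

Let eta2 : Cstar R := (Defs.eta R * Defs.eta R)%g.
Let eta3 : Cstar R := (eta2 * Defs.eta R)%g.

Lemma G_eta2 : G (el 0 (2 * s) eta2).
Proof.
have := subgroupM sG _ _ Geta Geta; rewrite elM_axis sqn_eta.
by congr (G (el _ _ _)); ring.
Qed.

Lemma G_eta3 : G (el 0 (3 * s) eta3).
Proof.
have := subgroupM sG _ _ G_eta2 Geta; rewrite elM_axis val_cstarM sqnM sqn_eta.
by congr (G (el _ _ _)); ring.
Qed.

Let val_eta3 : val eta3 = -1. Proof. exact: eta_cube. Qed.

Lemma rotation_height : exists k : int, 6 * s = k%:~R * c.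
Proof.
apply/Gc; have := subgroupM sG _ _ G_eta3 G_eta3; rewrite elM_axis val_eta3.
congr (G (el _ _ _)); first by rewrite /sqn /=; ring.
by apply: val_inj; rewrite val_cstarM val_eta3 mulN1r opprK.
Qed.

(** An element over [-1] of height zero is an involution. *)
Lemma no_half_turn z t : G (el z t 1%g) -> t + 3 * s != 0.
Proof.
move=> Gz; apply/eqP => ts0.
have Gx := subgroupM sG _ _ Gz G_eta3.
rewrite elM_axis mul1g sqn1 mul1r ts0 in Gx.
have : el z 0 eta3 = 1%g.
  apply: (tfG _ 2%N) => //; rewrite expg2 elM val_eta3 /el.
  congr ((_, _), _); first by ring.
    by rewrite ImJ; case: z {Gz Gx} => a b; rewrite /sqn /=; ring.
  by apply: val_inj; rewrite val_cstarM val_eta3 mulN1r opprK.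
move=> x1.
have : Re (val eta3) = 1 := congr1 (fun x : heisC R => Re (val x.2)) x1.
by rewrite val_eta3 /=; lra.
Qed.

(** The cube of an element over [eta^2] with planar part [z] and height [r]
    is vertical of height [3 r - 2 e |z|^2]. *)
Lemma no_third_turn z t : G (el z t 1%g) -> 3 * (t + 2 * s) != 2 * e * sqn z.
Proof.
move=> Gz; apply/eqP => ts0; have e2 := @Im_eta_sqr R.
have Gx := subgroupM sG _ _ Gz G_eta2; rewrite elM_axis mul1g sqn1 mul1r in Gx.
have val_eta2 : val eta2 = (- 2^-1) +i* e.
  by rewrite val_cstarM eta_sqr [in LHS]etaE; congr (_ +i* _) => /=; lra.
have : el z (t + 2 * s) eta2 = 1%g.
  apply: (tfG _ 3%N) => //.
  rewrite !expgS expg0 mulg1 [X in (_ * X)%g]elM elM val_eta2.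
  (* [eta2] is the primitive cube root of unity [- 1/2 + i e]. *)
  move: ts0 e2 {val_eta2 Gx Gz}; move: (t + 2 * s) => r.
  set x := e => ts0 e2; rewrite /el; congr ((_, _), _).
  - case: z {ts0} => a b /=; have ea : a * x ^+ 2 = a * (3 / 4) by rewrite e2.
    have eb : b * x ^+ 2 = b * (3 / 4) by rewrite e2.
    by congr (_ +i* _); lra.
  - have -> : sqn (- 2^-1 +i* x) = 1 by rewrite /sqn /=; lra.
    by rewrite !ImJ; move: ts0; case: z => a b; rewrite /sqn /= => ts0; lra.
  - apply: val_inj; rewrite -[RHS]/(1 : C) (_ : 1 = val eta3 * val eta3).
      by rewrite !val_cstarM; ring.
    by rewrite val_eta3 mulrNN mulr1.
move=> x1.
have : Re (val eta2) = 1 := congr1 (fun x : heisC R => Re (val x.2)) x1.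
by rewrite val_eta2 /=; lra.
Qed.

(** With [6 s = k c], each of [k2], [Nk2], [k3], [Nk3] below excludes torsion
    at one lift: those of [0] and of [1], over [-1] and over [eta^2]. *)
Lemma standard_position_classification :
  ~~ odd N /\
  ((N %% 3)%N = 0%N -> G = Gamma_c c \/ G = Gamma_c' c) /\
  ((N %% 3)%N = 1%N -> G = Gamma_c c) /\
  ((N %% 3)%N = 2%N -> G = Gamma_c' c).
Proof.
have [k sE] := rotation_height; have [j0 Gj0] := horizontal_height.
have Gv j : G (el 0 (j%:~R * c) 1%g) by apply/Gc; exists j.
have Gh (j : int) : G (el 1 (j%:~R * c - 2 * e) 1%g).
  have := vertical_shift _ _ (j - j0) Gj0; congr (G (el _ _ _)).
  by rewrite rmorphB /=; ring.
have [i2 i3] : 2%:~R = 2 :> R /\ 3%:~R = 3 :> R by [].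
have k2 (j : int) : 2 * j + k <> 0.
  move=> jk; have /negP := no_half_turn _ _ (Gv j); apply; apply/eqP.
  have : (2 * j + k)%:~R * c = 0 by rewrite jk mul0r.
  by rewrite rmorphD rmorphM /= i2; lra.
have Nk2 (j : int) : 2 * j - N%:Z + k <> 0.
  move=> jk; have /negP := no_half_turn _ _ (Gh j); apply; apply/eqP.
  have : (2 * j%:~R - N%:R + k%:~R) * c = 0.
    by rewrite -i2 [N%:R]pmulrn -rmorphM -rmorphB -rmorphD jk mul0r.
  by move: eN; lra.
have k3 (j : int) : 3 * j + k <> 0.
  move=> jk; have /negP := no_third_turn _ _ (Gv j); apply; apply/eqP.
  have : (3 * j + k)%:~R * c = 0 by rewrite jk mul0r.
  by rewrite rmorphD rmorphM /= i3 /sqn /=; lra.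
have Nk3 (j : int) : 3 * j + k - 2 * N%:Z <> 0.
  move=> jk; have /negP := no_third_turn _ _ (Gh j); apply; apply/eqP.
  have : (3 * j%:~R + k%:~R - 2 * N%:R) * c = 0.
    by rewrite -i2 -i3 [N%:R]pmulrn -!rmorphM -rmorphD -rmorphB jk mul0r.
  by rewrite sqn1; move: eN; lra.
have evenN : ~~ odd N.
  apply/negP => oN.
  have := k2 (- (k %/ 2)%Z); have := Nk2 (- ((k - N%:Z) %/ 2)%Z); lia.
have Gh0 : G (el 1 0 1%g).
  have := Gh (N./2); congr (G (el _ _ _)).
  have : N%:R = 2 * (N./2)%:R :> R.
    by rewrite -natrM (_ : 2 * N./2 = N)%N //; lia.
  by rewrite -pmulrn => NE; move: eN; rewrite NE; lra.
have Geta0 : G (el eta 0 1%g) by rewrite -[eta]mulr1; exact: rotate.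
have Gpsi (q : int) : G (psi (s - q%:~R * c)).
  have := subgroupM sG _ _ (Gv (- q)) Geta; rewrite elM_axis mul1g sqn1 mul1r.
  by congr (G (el _ _ _)); rewrite rmorphN mulNr addrC.
have eqc (q : int) : k = 6 * q + 1 -> G = Gamma_c c.
  move=> kE; apply: eq_generated_psi => //; have := Gpsi q; congr (G (psi _)).
  by move: sE; rewrite kE rmorphD rmorphM /=; lra.
have eqc' (q : int) : k = 6 * q + 5 -> G = Gamma_c' c.
  move=> kE; apply: eq_generated_psi => //; have := Gpsi q; congr (G (psi _)).
  by move: sE; rewrite kE rmorphD rmorphM /=; lra.
have k6 : k = 6 * (k %/ 6)%Z + 1 \/ k = 6 * (k %/ 6)%Z + 5.
  by have := k2 (- (k %/ 2)%Z); have := k3 (- (k %/ 3)%Z); lia.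
have kN := Nk3 (- ((k - 2 * N%:Z) %/ 3)%Z).
split=> //; split=> [_|]; first by case: k6 => /[dup]; [left|right]; eauto.
split=> N3; case: k6 => kE; eauto; lia.
Qed.

End StandardPosition.

(** * The classification *)

Theorem proposition8p1 (R : realType) (Gamma : set (heisC R)) (N : nat) :
  heisenberg_bieberbach Gamma ->
  [set pr2 x | x in Gamma] = generated [set eta R] ->
  let Lambda := Gamma `&` range (@inH R) in
  lcosets (group_center Lambda) (derived Lambda) #= `I_N ->
  let c : R := 4 * complex.Im (val (eta R)) / N%:R in
  ~~ odd N /\
  ((N %% 3)%N = 0%N ->
     conjugate Gamma (Gamma_c c) \/ conjugate Gamma (Gamma_c' c)) /\
  ((N %% 3)%N = 1%N -> conjugate Gamma (Gamma_c c)) /\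
  ((N %% 3)%N = 2%N -> conjugate Gamma (Gamma_c' c)).
Proof.
move=> HB prG Lambda cardN c.
have [sG _ dG tfG _] := HB.
have [[[w s] l] Gg /= lE] : [set pr2 x | x in Gamma] (eta R).
  by rewrite prG; exact: sub_generated.
move: lE Gg => {l}-> Gg; rewrite /pr2 /= -/(el w s (eta R)) in Gg.
have [d d0 Gd] := exists_vertical_period _ _ sG dG tfG Gg.
have [a a0 Ga] := exists_horizontal_ideal _ _ _ sG Gg d0 Gd
  (exists_horizontal _ _ HB Gg).
have Nd : N%:R * d = 4 * (sqn a * complex.Im (val (eta R))).
  exact: (lattice_index sG a0 d0 Gd Ga).
have e0 := @Im_eta_gt0 R; have sa0 : 0 < sqn a by rewrite sqn_gt0.
have N0 : (0 < N)%N.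
  rewrite lt0n; apply/eqP => N0; move: Nd; rewrite N0 mul0r => /esym/eqP.
  by rewrite gt_eqF // !mulr_gt0.
set g := el (w / (1 - val (eta R))) 0 (cstar a0).
have cE : c = d / sqn a.
  have sa1 := lt0r_neq0 sa0; apply/eqP.
  rewrite eqr_div ?pnatr_eq0 -?lt0n // [d * _]mulrC Nd; apply/eqP; ring.
have [s' Gs'] := conj_by_rotation _ _ (cstar a0) _ Gg.
have pr2_conj x : conj_by g Gamma x -> generated [set eta R] (pr2 x).
  move=> Gx; have : [set pr2 x | x in Gamma] (pr2 (g * x * g^-1)%g).
    by exists (g * x * g^-1)%g.
  rewrite prG; congr (generated _ _); apply: val_inj.
  by rewrite /= mulrAC mulfV ?mul1r.
have period1 : vertical_period (conj_by g Gamma) c.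
  by rewrite cE; exact: conj_by_period.
have ideal1 : horizontal_ideal (conj_by g Gamma) 1 by exact: conj_by_ideal.
have [evenN [N0' [N1 N2]]] := standard_position_classification
  (subgroup_conj_by g _ sG) (conj_by_torsion_free g _ tfG) pr2_conj
  N0 period1 ideal1 Gs'.
have conjE K : conj_by g Gamma = K -> conjugate Gamma K.
  exact: conjugate_conj_by.
split=> //; split=> [/N0'[]/conjE|]; [by left|by right|].
by split=> [/N1|/N2] /conjE.
Qed.
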